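(* Let $\mathcal{H}$ be a real Hilbert space, $N\ge1$ an integer and $\beta>0$. Let $A_0,A_1,\dots,A_N$ and $C_1,\dots,C_N$ be maximal monotone operators on $\mathcal{H}$ such that each $C_i$, $i\in\{1,\dots,N\}$, has full domain and is $1/\beta$-cocoercive. Let $\gamma\in(0,4/\beta)$ and let $\{\theta_k\}_{k\in\mathbb{N}}$ satisfy $\theta_k\in\big[0,2-\frac{\gamma\beta}{2}\big]$ for all $k$ and $\sum_k\theta_k\big(2-\frac{\gamma\beta}{2}-\theta_k\big)=+\infty$. Let $\widetilde{w}^0=(\widetilde w^0_1,\dots,\widetilde w^0_N)\in\mathcal{H}^N$ and let $\widetilde{w}^k=(\widetilde{w}_1^k,\dots,\widetilde{w}_N^k)$, $k\in\mathbb{N}$, be generated by the sequential forward Douglas--Rachford scheme $$\begin{cases} x_0^{k+1}=J_{\gamma A_0}\widetilde{w}_1^{k},\\ x_i^{k+1}=J_{\frac{\gamma}{2}A_i}\Big(x_{i-1}^{k+1}+\frac{\widetilde{w}_{i+1}^{k}-\widetilde{w}_{i}^{k}}{2}-\frac{\gamma}{2}C_{i}x_{i-1}^{k+1}\Big) & \text{for } i\in\{1,\dots,N-1\},\\ x_N^{k+1}=J_{\gamma A_N}\big(2x_{N-1}^{k+1}-\widetilde{w}_{N}^k-\gamma C_{N}x_{N-1}^{k+1}\big),\\ \widetilde{w}_i^{k+1}=\widetilde{w}_i^k+\theta_k(x_{i}^{k+1}-x_{i-1}^{k+1}) & \text{for } i\in\{1,\dots,N\}. \end{cases}$$ If there exists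 a solution to the problem of finding $x\in\mathcal{H}$ such that $0\in A_0x+\sum_{i=1}^N[A_ix+C_ix]$, then $\{\widetilde{w}^k\}_k$ converges weakly to a $\widetilde{w}^*\in\mathcal{H}^N$ such that $x^*:=J_{\gamma A_0}\widetilde{w}_1^*$ is a solution to this problem. Moreover, the sequences $\{x_i^k\}_k$, for $i\in\{0,\dots,N\}$, converge weakly to this solution $x^*$.
   Context: $J_A:=(I+A)^{-1}$ denotes the resolvent of a maximal monotone operator $A$. A single-valued operator $C$ is $1/\beta$-cocoercive if $\langle Cx-Cy,x-y\rangle\ge\frac1\beta\|Cx-Cy\|^2$ for all $x,y$ in its domain. *)

(* Defs.v *)
(* A real Hilbert space is a complete normed module [H] over [R : realType]
   together with an inner product [dot : {dot H for idfun}] (a positive definite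
   symmetric bilinear form) inducing the norm of [H].  The operator-theoretic
   notions below only need the underlying function of [dot]. *)
From mathcomp Require Export all_boot all_order all_algebra.
From mathcomp Require Export all_classical all_reals all_analysis.
Export Order.TTheory GRing.Theory Num.Theory.
Export numFieldNormedType.Exports.

Set Implicit Arguments.
Unset Strict Implicit.
Unset Printing Implicit Defensive.

Local Open Scope classical_set_scope.
Local Open Scope ring_scope.

Section Operators.
Context {R : realType} {H : normedModType R}.
Implicit Types (A B : H -> set H) (C : H -> H) (dot : H -> H -> R).

Definition op_zero : H -> set H := fun=> [set 0].
Definition op_id : H -> set H := fun x => [set x].
Definition op_of_fun C : H -> set H := fun x => [set C x].
Definition op_add A B : H -> set H :=
  fun x => [set u + v | u in A x & v in B x].
Definition op_scale (c : R) A : H -> set H := fun x => [set c *: u | u in A x].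
Definition op_inv A : H -> set H := fun u => [set x | A x u].

Definition monotone_op dot A : Prop :=
  forall x y u v, A x u -> A y v -> 0 <= dot (u - v) (x - y).

Definition maximal_monotone dot A : Prop :=
  monotone_op dot A /\
  forall B, monotone_op dot B -> (forall x, A x `<=` B x) -> B = A.

Definition cocoercive dot (c : R) C : Prop :=
  forall x y, c * `|C x - C y| ^+ 2 <= dot (C x - C y) (x - y).

Definition resolvent_op A : H -> set H := op_inv (op_add op_id A).

(* [resolvent_op A] is everywhere defined and single-valued when [A] is maximal
   monotone (Minty); [resolvent A] is it as a function, and the default value [0]
   is only used outside of the domain of [resolvent_op A]. *)
Definition resolvent A : H -> H := fun u => xget 0 (resolvent_op A u).

End Operators.

(* Weak convergence for the pairing [dot]: in a Hilbert space every continuous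
   linear form is an inner product with a fixed vector. *)
Definition weak_cvg {R : realType} {V : Type} (dot : V -> V -> R)
    (u : nat -> V) (l : V) : Prop :=
  forall y, dot (u k) y @[k --> \oo] --> dot l y.

Definition prod_dot {R : realType} {H : Type} (dot : H -> H -> R) (N : nat)
    (u v : 'I_N -> H) : R :=
  \sum_(i < N) dot (u i) (v i).

(* Index conventions, with N = n.+1.  The families A_0, ..., A_N and
   x_0, ..., x_N are indexed by ['I_n.+2]; the families C_1, ..., C_N and
   w_1, ..., w_N are indexed by ['I_n.+1], the element of value j standing for
   the index i = j + 1.  For such a j, [idx j] and [idx_pred j] in ['I_n.+2] have
   values i and i - 1. *)
Definition idx {n : nat} (j : 'I_n.+1) : 'I_n.+2 := lift ord0 j.
Definition idx_pred {n : nat} (j : 'I_n.+1) : 'I_n.+2 :=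
  widen_ord (leqnSn n.+1) j.

Section SequentialFDR.
Context {R : realType} {H : normedModType R} {n : nat}.
Variables (A : 'I_n.+2 -> H -> set H) (C : 'I_n.+1 -> H -> H).

Definition inclusion_solution (x : H) : Prop :=
  op_add (A ord0)
    (\big[op_add/op_zero]_(j < n.+1) op_add (A (idx j)) (op_of_fun (C j))) x 0.

(* In the second clause j ranges over ['I_n], so that [widen_ord _ j] and
   [lift ord0 j] in ['I_n.+1] stand for i and i + 1, where i = j + 1 < N. *)
Definition sfdr_step (gamma theta : R) (w w' : 'I_n.+1 -> H)
    (x' : 'I_n.+2 -> H) : Prop :=
  [/\ x' ord0 = resolvent (op_scale gamma (A ord0)) (w ord0),
      forall j : 'I_n,
        let i := widen_ord (leqnSn n) j in
        let i1 := lift ord0 j in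
        x' (idx i) = resolvent (op_scale (gamma / 2) (A (idx i)))
          (x' (idx_pred i) + 2^-1 *: (w i1 - w i)
           - (gamma / 2) *: C i (x' (idx_pred i))),
      x' ord_max = resolvent (op_scale gamma (A ord_max))
        (2 *: x' (idx_pred ord_max) - w ord_max
         - gamma *: C ord_max (x' (idx_pred ord_max)))
    & forall i : 'I_n.+1,
        w' i = w i + theta *: (x' (idx i) - x' (idx_pred i))].

End SequentialFDR.

(* Main.v *)
Require Import Defs.
From mathcomp Require Import ring lra.

(** Write [r_i = x_i - x_{i-1}] for the residuals of one sweep.  Unfolding the
    resolvents, a sweep started at [w] produces points of the graphs of the
    [A_i]: [gamma^-1 *: dual w x c i] belongs to [A_i x_i], where
    [c_i = C_i x_{i-1}] and [dual w x c i] is a linear expression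
    in [w], [x] and [c].  Such a pair [(w, x)] is called a state below.  A state
    whose [x] is constant equal to [z] has [r = 0], hence is a fixed point of the
    scheme, and [z] is then a solution, as the dual variables telescope to
    [- gamma (c_1 + ... + c_N)]; conversely every solution comes from such a
    state ([inclusion_state]).

    All estimates come from one identity, [dual_energy]: the pairing of the dual
    variables with the primal ones equals
    [- <w, r> - |r|^2 - gamma <c, x>], where [c_i] is paired with [x_i].
    Applied to the difference of two states, together with monotonicity of
    the [A_i] and cocoercivity of the [C_i], it gives
    [2 <dw, dr> + (2 - gamma beta / 2) |dr|^2 <= 0] ([sfdr_state_monotone]).
    Hence the distance of [w^k] to a fixed point decreases, with a gain
    [theta_k (2 - gamma beta / 2 - theta_k) |r^k|^2], and [|r^k|] does not
    increase; as the sum of the relaxation weights diverges, [r^k] tends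
    to [0] ([energy_cvg0]).

    Weak compactness is used through ultrafilters on the indices rather than
    through subsequences, so that nonseparable spaces are covered: a bounded
    sequence has a weak limit along each ultrafilter ([bounded_weak_limit]).  Applied once
    more to the iterates, the identity shows that the pairing of the dual and
    primal variables converges to that of their weak limits; maximal monotonicity
    then puts the weak limits back in the graphs
    ([maximal_monotone_weak_closed]), so they form a fixed point
    ([ultrafilter_cluster]).  Since the distances to all fixed points converge,
    Opial's argument shows that this fixed point is the same for all ultrafilters
    ([weak_limit_unique]), which is convergence along the integers
    ([cvg_ultrafilter]).

    Two facts on Hilbert spaces support this: Minty's surjectivity theorem
    ([minty]), by which the resolvents are everywhere defined, and the existence
    of weak limits.  Both are obtained by minimising a strongly convex function
    ([strongly_convex_min]). *)

Local Open Scope classical_set_scope.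
Local Open Scope ring_scope.

(** * Minimisation of strongly convex functions *)

(** Completeness is stated for sequences so that it passes to the product
    [H * H], where the minimisation behind Minty's theorem takes place. *)
Definition seq_complete {R : realType} (V : normedModType R) : Prop :=
  forall u : nat -> V, cauchy (u @ \oo) -> exists l : V, u @ \oo --> l.

Lemma complete_seq_complete {R : realType} (V : completeNormedModType R) :
  seq_complete V.
Proof. by move=> u uc; exists (lim (u @ \oo)); exact: (@cauchy_cvg V). Qed.

Lemma prod_seq_complete {R : realType} {V W : normedModType R} :
  seq_complete V -> seq_complete W -> seq_complete (V * W)%type.
Proof.
move=> cV cW u /cauchy_ballP uc.
have /cV[a ua] : cauchy ((fst \o u) @ \oo).
  apply/cauchy_ballP => e e0; have := uc e e0.
  by rewrite !near_simpl; apply: filterS => -[i j] [].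
have /cW[b ub] : cauchy ((snd \o u) @ \oo).
  apply/cauchy_ballP => e e0; have := uc e e0.
  by rewrite !near_simpl; apply: filterS => -[i j] [].
exists (a, b); apply/cvg_ballP => e e0; near=> k.
by split; near: k; [exact: (cvg_ball ua e0) | exact: (cvg_ball ub e0)].
Unshelve. all: by end_near.
Qed.

Section StronglyConvex.
Context {R : realType} {V : normedModType R} (V_complete : seq_complete V).

(** The relation [P v r] stands for [phi v <= r], which accommodates functions
    [phi] with infinite values: only the epigraph is ever used.  The midpoint
    inequality forces every minimising sequence to be Cauchy, and closedness of
    the epigraph makes its limit a minimiser. *)
Lemma strongly_convex_min (P : V -> R -> Prop) (c m : R) :
  0 < c -> (exists v r, P v r) -> (forall v r, P v r -> m <= r) ->
  (forall v w r s, P v r -> P w s ->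
     P (2^-1 *: (v + w)) ((r + s) / 2 - c * `|v - w| ^+ 2)) ->
  (forall (u : nat -> V) (r : nat -> R) v s, (forall k, P (u k) (r k)) ->
     u @ \oo --> v -> r @ \oo --> s -> P v s) ->
  exists v s, P v s /\ forall w t, P w t -> s <= t.
Proof.
move=> c0 [v0 [r0 P0]] Pm Pmid Pcl.
pose S : set R := [set r | exists v, P v r].
have S0 : S r0 by exists v0.
have infS : has_inf S.
  by split; [exists r0 | exists m => r [v /Pm]].
have infle w t : P w t -> inf S <= t.
  by move=> Pwt; apply: (ge_inf infS.2); exists w.
have /choice[f Pf] : forall k : nat, exists p : V * R,
    P p.1 p.2 /\ p.2 < inf S + k.+1%:R^-1.
  move=> k; have k0 : 0 < k.+1%:R^-1 :> R by rewrite invr_gt0.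
  by have [r [v Pvr] rlt] := inf_adherent k0 infS; exists (v, r).
pose u k := (f k).1; pose r k := (f k).2.
have rcvg : r @ \oo --> inf S.
  apply: (@squeeze_cvgr _ _ _ _ (fun=> inf S) (fun k => inf S + k.+1%:R^-1)).
  - by near=> k; rewrite (infle (u k) _ (Pf k).1)/= ltW// (Pf k).2.
  - exact: cvg_cst.
  - rewrite -[X in _ --> X]addr0; apply: cvgD; first exact: cvg_cst.
    exact: (@cvg_harmonic R).
have ucauchy : cauchy (u @ \oo).
  apply/cauchy_exP => e e0.
  have d0 : 0 < c * e ^+ 2 by rewrite mulr_gt0// exprn_gt0.
  have : \forall k \near \oo, r k < inf S + c * e ^+ 2.
    by apply: (cvgr_lt (inf S)) => //; rewrite ltrDl.
  move=> [N _ HN]; exists (u N), N => //= k Nk.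
  rewrite -ball_normE /ball_ /=.
  (* The value at the midpoint is at least the infimum, which bounds the
     squared distance by the excess of the two values. *)
  rewrite -(@ltr_pXn2r _ 2)// ?nnegrE//; last exact: ltW.
  rewrite -(ltr_pM2l c0).
  have := infle _ _ (Pmid _ _ _ _ (Pf N).1 (Pf k).1).
  have /= := HN N (leqnn N); have /= := HN k Nk.
  rewrite /r /u; lra.
have [l ul] := V_complete u ucauchy.
by exists l, (inf S); split => //; apply: Pcl ul rcvg => k; exact: (Pf k).1.
Unshelve. all: by end_near.
Qed.
End StronglyConvex.

(** Lets [t] tend to [0]: it turns the comparison of a minimum with the values
    along a segment into a first-order condition. *)
Lemma ler_small_slope {R : realFieldType} (a b e : R) : 0 <= e ->
  (forall t, 0 < t < 1 -> a <= b + t * e) -> a <= b.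
Proof.
move=> e0 h; have [//|ba] := leP a b; set d := a - b.
have d0 : 0 < d by rewrite subr_gt0.
have p : 0 < d + e + 1 by lra.
have /h : 0 < d / (d + e + 1) < 1.
  by rewrite divr_gt0//= ltr_pdivrMr//; lra.
have : d / (d + e + 1) * e < d.
  by rewrite mulrAC ltr_pdivrMr// ltr_pM2l//; lra.
rewrite /d; lra.
Qed.

(** * Inner products *)

Section InnerProduct.
Context {R : realType} {H : normedModType R} {dot : {dot H for idfun}}.

Lemma dotDl x y z : dot (x + y) z = dot x z + dot y z.
Proof. by rewrite linearDl. Qed.
Lemma dotDr x y z : dot z (x + y) = dot z x + dot z y.
Proof. by rewrite linearDr. Qed.
Lemma dotZl a x z : dot (a *: x) z = a * dot x z.
Proof. by rewrite linearZl_LR. Qed.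
Lemma dotZr a x z : dot z (a *: x) = a * dot z x.
Proof. by rewrite linearZr. Qed.
Lemma dotNl x z : dot (- x) z = - dot x z.
Proof. by rewrite -scaleN1r dotZl mulN1r. Qed.
Lemma dotNr x z : dot z (- x) = - dot z x.
Proof. by rewrite -scaleN1r dotZr mulN1r. Qed.
Lemma dot0l x : dot 0 x = 0.
Proof. by rewrite -(scale0r (0 : H)) dotZl mul0r. Qed.
Lemma dot0r x : dot x 0 = 0.
Proof. by rewrite -(scale0r (0 : H)) dotZr mul0r. Qed.
Lemma dotC x y : dot x y = dot y x.
Proof. by rewrite hermC expr0 mul1r. Qed.
Definition dotE := (dotDl, dotDr, dotNl, dotNr, dotZl, dotZr, dot0l, dot0r).

Context (dot_norm : forall x : H, dot x x = `|x| ^+ 2).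

Lemma dot_ge0 x : 0 <= dot x x.
Proof. by rewrite dot_norm sqr_ge0. Qed.

Lemma dot_eq0 x : dot x x <= 0 -> x = 0.
Proof.
rewrite dot_norm => h; apply/eqP; rewrite -normr_eq0 -sqrf_eq0.
by rewrite eq_le h sqr_ge0.
Qed.

Lemma dot_CauchySchwarz x y : `|dot x y| <= `|x| * `|y|.
Proof.
have [->|x0] := eqVneq x 0; first by rewrite dot0l !normr0 mul0r.
have [->|y0] := eqVneq y 0; first by rewrite dot0r !normr0 mulr0.
have p : 0 < `|x| * `|y| by rewrite mulr_gt0// normr_gt0.
have := dot_ge0 (`|y| *: x + `|x| *: y).
have := dot_ge0 (`|y| *: x - `|x| *: y).
rewrite !dotE (dotC y x) !dot_norm => h1 h2.
by rewrite ler_norml; apply/andP; split; rewrite -(ler_pM2l p); lra.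
Qed.

Section Limits.
Context {T : Type} {F : set_system T} {FF : ProperFilter F}.

Lemma dot_cvg0 (u v : T -> H) (M : R) : `|u k| @[k --> F] --> 0 ->
  (forall k, `|v k| <= M) -> dot (u k) (v k) @[k --> F] --> 0.
Proof.
move=> u0 vM; apply/norm_cvg0P.
apply: (@squeeze_cvgr _ _ _ _ (fun=> 0) (fun k => `|u k| * M)).
- near=> k; rewrite normr_ge0/= (le_trans (dot_CauchySchwarz _ _))//.
  by rewrite ler_wpM2l.
- exact: cvg_cst.
- by rewrite -(mul0r M); apply: cvgM => //; exact: cvg_cst.
Unshelve. all: by end_near.
Qed.

Lemma dot_cvgl (u : T -> H) l y :
  u @ F --> l -> dot (u k) y @[k --> F] --> dot l y.
Proof.
move=> ul; have : dot (u k - l) y @[k --> F] --> 0.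
  apply: (@dot_cvg0 _ (fun=> y) `|y|) => // .
  rewrite -(normr0 H) -(subrr l); apply: cvg_norm.
  by apply: cvgB => //; exact: cvg_cst.
move=> d0; rewrite -[X in _ --> X](addr0 (dot l y)).
have -> : (fun k => dot (u k) y) = (fun k => dot l y + dot (u k - l) y).
  by apply/funext => k; rewrite dotDl dotNl addrC subrK.
by apply: cvgD => //; exact: cvg_cst.
Qed.

Lemma dot_cvgr (u : T -> H) l y :
  u @ F --> l -> dot y (u k) @[k --> F] --> dot y l.
Proof.
move=> /(@dot_cvgl u l y); rewrite dotC.
by have -> : (fun k => dot (u k) y) = (fun k => dot y (u k));
  first by apply/funext => k; rewrite dotC.
Qed.

End Limits.
End InnerProduct.

(** * Minty's theorem *)

Section Minty.
Context {R : realType} {H : completeNormedModType R} {dot : {dot H for idfun}}.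
Context (dot_norm : forall x : H, dot x x = `|x| ^+ 2).

(** Maximality tested on one additional point of the graph at a time; this form
    is stable under the affine changes of variables made in [minty]. *)
Definition pointwise_maximal (A : H -> set H) : Prop :=
  forall x u, (forall y v, A y v -> 0 <= dot (u - v) (x - y)) -> A x u.

(** Otherwise adding the point [(x, u)] to the graph would give a proper monotone
    extension. *)
Lemma maximal_monotone_pointwise (A : H -> set H) :
  maximal_monotone dot A -> pointwise_maximal A.
Proof.
move=> [mA maxA] x u h.
pose B := fun z => A z `|` [set p | z = x /\ p = u].
suff <- : B = A by right.
apply: maxA => [y z v w|z p Ap]; last by left.
case=> [Ayv|[-> ->]] [Azw|[-> ->]].
- exact: mA.
- by rewrite -(opprB u v) -(opprB x y) dotNl dotNr opprK; exact: h.
- exact: h.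
- by rewrite !subrr dot0l.
Qed.

(** Let [G y v] be the affine function [(x, u) |-> <x, v> + <y, u> - <y, v>].  The
    supremum of the [G y v] over the graph of [A] is the Fitzpatrick function
    [F] of [A]; it satisfies [<x, u> <= F (x, u)], with equality on the graph.
    Adding half the squared norm makes it strongly convex, so it has a
    minimiser [(x, u)].  The first-order condition at the minimiser shows that
    [(- u, - x)] is monotonically related to the whole graph, hence lies in it,
    and then, tested at that very point, that [x + u = 0]. *)
Lemma minty0 (A : H -> set H) : monotone_op dot A -> pointwise_maximal A ->
  exists x, A x (- x).
Proof.
move=> mA maxA.
pose q (p : H * H) := 2^-1 * (dot p.1 p.1 + dot p.2 p.2).
pose G (y v : H) (p : H * H) := dot p.1 v + dot y p.2 - dot y v.
pose P (p : H * H) (r : R) := forall y v, A y v -> G y v p + q p <= r.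
(* If this failed, [(x, u)] would be monotonically related to the graph, hence
   belong to it, and testing [h] at [(x, u)] itself would be contradictory. *)
have Fitz x u r : (forall y v, A y v -> G y v (x, u) <= r) -> dot x u <= r.
  move=> h; have [//|rlt] := leP (dot x u) r.
  have Axu : A x u.
    apply: maxA => y v /h; rewrite /G/= !dotE (dotC u x) (dotC v x).
    rewrite (dotC u y) (dotC v y); lra.
  by have := h _ _ Axu; rewrite /G/=; lra.
have Glip x u y v : A x u -> A y v -> G y v (x, u) <= dot x u.
  move=> Axu Ayv; have := mA _ _ _ _ Axu Ayv.
  rewrite /G/= !dotE (dotC u x) (dotC v x).
  rewrite (dotC u y) (dotC v y); lra.
have Plow p r : P p r -> dot p.1 p.2 + q p <= r.
  case: p => x u Pr; rewrite -lerBrDr; apply: Fitz => y v /Pr.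
  by rewrite lerBrDr.
have [[y0 v0] Ay0] : exists p : H * H, A p.1 p.2.
  apply: contrapT => nA; apply: (nA); exists (0, 0) => /=.
  by apply: maxA => y v Ayv; exfalso; apply: nA; exists (y, v).
have HH := prod_seq_complete (complete_seq_complete H) (complete_seq_complete H).
have [|||||[x u] [r [Pr rmin]]] := strongly_convex_min HH P 8^-1 0.
- by rewrite invr_gt0.
- exists (y0, v0), (dot y0 v0 + q (y0, v0)) => y v Ayv.
  by rewrite lerD2r; exact: Glip.
- move=> p r /Plow; apply: le_trans; case: p => x u; rewrite /q /=.
  have := dot_ge0 dot_norm (x + u); rewrite !dotE (dotC u x); lra.
- move=> [x u] [x' u'] r s Pr Ps y v Ayv.
  have /= := Pr _ _ Ayv; have /= := Ps _ _ Ayv.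
  have : `|(x, u) - (x', u')| ^+ 2 <=
      dot (x - x') (x - x') + dot (u - u') (u - u').
    rewrite !dot_norm [`|(x, u) - (x', u')|]/(Num.max `|x - x'| `|u - u'|).
    by case: leP => _; rewrite ?lerDr ?lerDl sqr_ge0.
  rewrite /G /q /= !dotE (dotC x' x) (dotC u' u); lra.
- move=> p r [x u] s Pk cp cr y v Ayv.
  have cx : (fst \o p) @ \oo --> x.
    by apply: (@cvg_comp _ _ _ p fst _ _ _ cp); exact: cvg_fst.
  have cu : (snd \o p) @ \oo --> u.
    by apply: (@cvg_comp _ _ _ p snd _ _ _ cp); exact: cvg_snd.
  have csq (f : nat -> H) (l : H) : f @ \oo --> l ->
      dot (f k) (f k) @[k --> \oo] --> dot l l.
    move=> fl; rewrite dot_norm; under eq_cvg do rewrite dot_norm expr2.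
    by rewrite expr2; apply: cvgM; apply: cvg_norm.
  apply: (ler_cvg_to _ cr).
    apply: cvgD.
      apply: cvgB; last exact: cvg_cst.
      by apply: cvgD; [exact: dot_cvgl cx | exact: dot_cvgr cu].
    apply: cvgM; first exact: cvg_cst.
    by apply: cvgD; [exact: csq cx | exact: csq cu].
  by near=> k; exact: Pk.
(* The first-order condition at the minimiser in the direction of the graph
   point [(y, v)], combined with [Plow]. *)
have key y v : A y v ->
    dot x u + 2 * q (x, u) <= dot y v + dot x y + dot u v.
  move=> Ayv; have := Plow _ _ Pr; rewrite -lerBrDr /= => lowr.
  suff : r - q (x, u) <= dot y v + dot x (y - x) + dot u (v - u).
    by move: lowr; rewrite /q !dotE/=; lra.
  apply: (@ler_small_slope _ _ _ (q (y - x, v - u))) => [|t /andP[t0 t1]].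
    by rewrite /q mulr_ge0 ?invr_ge0// addr_ge0// dot_ge0.
  (* The point at parameter [t] of the segment from the minimiser to [(y, v)]. *)
  pose pt : H * H := (x + t *: (y - x), u + t *: (v - u)).
  have /rmin : P pt ((1 - t) * (r - q (x, u)) + t * dot y v + q pt).
    move=> y' v' Ayv'; rewrite lerD2r.
    have Gt : G y' v' pt = (1 - t) * G y' v' (x, u) + t * G y' v' (y, v).
      by rewrite /G /pt/= !dotE; ring.
    rewrite Gt lerD// ler_wpM2l ?subr_ge0 ?(ltW t1) ?(ltW t0)//.
      by rewrite lerBrDr; exact: Pr.
    exact: Glip.
  have -> : q pt = q (x, u) + t * (dot x (y - x) + dot u (v - u)) +
      t ^+ 2 * q (y - x, v - u).
    rewrite /q /pt/= (dotDl x) (dotDr x (t *: _)) (dotDl u) (dotDr u (t *: _)).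
    rewrite !dotZl !dotZr !(dotDr _ (t *: _)) !dotZr (dotC (y - x) x).
    by rewrite (dotC (v - u) u); field.
  move: (dot x _) (dot u (v - u)) (q (y - x, _)) => D D2 E h.
  by rewrite -(ler_pM2l t0); move: h; lra.
have Aux : A (- u) (- x).
  apply: maxA => y v /key.
  have := dot_ge0 dot_norm (x + u).
  rewrite /q/= !dotE (dotC u x) (dotC v y) (dotC v u); lra.
have /(dot_eq0 dot_norm)/eqP : dot (x + u) (x + u) <= 0.
  have := key _ _ Aux; rewrite /q/= !dotE (dotC u x); lra.
by rewrite addr_eq0 => /eqP xu; exists x; rewrite {1}xu.
Unshelve. all: by end_near.
Qed.

(** The case of a general right-hand side is [minty0] for the operator
    [x |-> g (A x) - b]. *)
Lemma minty (A : H -> set H) (g : R) (b : H) :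
  maximal_monotone dot A -> 0 < g ->
  exists x, A x (g^-1 *: (b - x)).
Proof.
move=> [mA maxA] g0.
have pA := maximal_monotone_pointwise A (conj mA maxA).
pose B : H -> set H := fun x => [set u | A x (g^-1 *: (b + u))].
have [||x] := @minty0 B.
- move=> x y u v Axu Ayv; have := mA _ _ _ _ Axu Ayv.
  by rewrite -scalerBr opprD addrACA subrr add0r dotZl pmulr_rge0 ?invr_gt0.
- move=> x u h; apply: pA => y v Ayv.
  have -> : g^-1 *: (b + u) - v = g^-1 *: (u - (g *: v - b)).
    by rewrite opprB addrA (addrC u) scalerBr scalerA mulVf ?gt_eqF// scale1r.
  rewrite dotZl pmulr_rge0 ?invr_gt0//; apply: h.
  by rewrite /B/= addrC subrK scalerA mulVf ?gt_eqF// scale1r.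
by rewrite /B => Bx; exists x.
Qed.
End Minty.

(** * Weak limits along ultrafilters *)

(** If some neighbourhood of [l] had a preimage outside of [F], then the
    complement of that preimage could be added to [F], and an ultrafilter
    containing both would contradict the hypothesis. *)
Lemma cvg_ultrafilter {T : Type} {X : topologicalType} (F : set_system T)
    {FF : ProperFilter F} (f : T -> X) (l : X) :
  (forall U, UltraFilter U -> F `<=` U -> f @ U --> l) -> f @ F --> l.
Proof.
move=> h A lA; apply: contrapT => nFA.
have GF : ProperFilter (within (~` (f @^-1` A)) F).
  apply: Build_ProperFilter; rewrite /within /= => F0; apply: nFA.
  by apply: filterS F0 => k /= kA; apply: contrapT => /kA.
have [U [UU FU]] := ultraFilterLemma GF.
have UA : U (f @^-1` A).
  by apply: (h U UU) lA => B FB; apply: FU; apply: filterS FB => ? ? _.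
have UnA : U (~` (f @^-1` A)) by apply: FU; apply: withinT.
by have [k [/= kA]] : exists k, (f @^-1` A `&` ~` (f @^-1` A)) k;
  first by apply: (@filter_ex _ U); exact: filterI.
Qed.

Section WeakLimits.
Context {R : realType} {H : completeNormedModType R} {dot : {dot H for idfun}}.
Context (dot_norm : forall x : H, dot x x = `|x| ^+ 2).

(** The weak limit is the asymptotic centre of the family: the minimiser of the
    function sending [c] to the limit of [|u_k - c|^2] along [U].  Moving the
    centre in the direction [y] cannot lower this function, which forces
    [<u_k - c, y>] to tend to [0]; the ultrafilter is used to decide the sign
    of this quantity. *)
Lemma bounded_weak_limit {T : Type} (U : set_system T) {UU : UltraFilter U}
    (u : T -> H) (M : R) : (forall k, `|u k| <= M) ->
  exists c, forall y, dot (u k) y @[k --> U] --> dot c y.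
Proof.
move=> uM.
pose P (c : H) (r : R) :=
  forall e, 0 < e -> \forall k \near U, dot (u k - c) (u k - c) <= r + e.
have [|||||c [r [Pr rmin]]] :=
  strongly_convex_min (complete_seq_complete H) P 4^-1 0.
- by rewrite invr_gt0.
- exists 0, (M ^+ 2) => e e0; near=> k.
  rewrite subr0 dot_norm -[leLHS]addr0 lerD ?(ltW e0)//.
  by rewrite lerXn2r ?nnegrE// (le_trans _ (uM k)).
- move=> c r Pr; apply/ler_addgt0Pr => e /Pr/filter_ex[k].
  exact: le_trans (dot_ge0 dot_norm _).
- move=> c d r s Pc Pd e e0; near=> k.
  have : dot (u k - c) (u k - c) <= r + e by near: k; exact: Pc.
  have : dot (u k - d) (u k - d) <= s + e by near: k; exact: Pd.
  rewrite -dot_norm !dotE (dotC (u k) c) (dotC (u k) d) (dotC d c); lra.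
- move=> v r c s Pv vc rs e e0.
  have lim0 : r n + 2 * (M + `|c|) * `|v n - c| @[n --> \oo] --> s.
    rewrite -[X in _ --> X]addr0; apply: cvgD => //.
    rewrite -(mulr0 (2 * (M + `|c|))); apply: cvgM; first exact: cvg_cst.
    rewrite -(normr0 H) -(subrr c); apply: cvg_norm.
    by apply: cvgB => //; exact: cvg_cst.
  have e2 : 0 < e / 2 by rewrite divr_gt0.
  have [n nlt] : exists n, r n + 2 * (M + `|c|) * `|v n - c| < s + e / 2.
    have lt_s : s < s + e / 2 by rewrite ltrDl.
    exact: (filter_ex (cvgr_lt s lim0 _ lt_s)).
  near=> k.
  have h1 : dot (u k - v n) (u k - v n) <= r n + e / 2 by near: k; exact: Pv.
  have h2 : dot (u k - c) (v n - c) <= (M + `|c|) * `|v n - c|.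
    rewrite (le_trans (ler_norm _))//.
    rewrite (le_trans (dot_CauchySchwarz dot_norm _ _))//.
    by rewrite ler_wpM2r// (le_trans (ler_normB _ _))// lerD2r.
  have h3 := dot_ge0 dot_norm (v n - c).
  move: h1 h2 h3; rewrite !dotE (dotC (u k) c) (dotC (u k) (v n)) (dotC (v n) c).
  lra.
have half y e : 0 < e -> \forall k \near U, dot (u k - c) y <= e.
  move=> e0; have [//|nU] := in_ultra_setVsetC [set k | dot (u k - c) y <= e] UU.
  exfalso; suff : 2 * e <= 0 by lra.
  apply: (ler_small_slope _ _ (dot y y)); first exact: dot_ge0.
  move=> t /andP[t0 t1].
  have /rmin : P (c + t *: y) (r - 2 * t * e + t ^+ 2 * dot y y).
    move=> d d0; have h := Pr d d0; near=> k.
    have h1 : dot (u k - c) (u k - c) <= r + d by near: k.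
    have h2 : e < dot (u k - c) y.
      by rewrite ltNge; apply/negP; near: k; exact: nU.
    have : t * e <= t * dot (u k - c) y by rewrite ler_pM2l// ltW.
    have -> : u k - (c + t *: y) = (u k - c) - t *: y by rewrite opprD addrA.
    move: (u k - c) h1 h2 => z h1 h2.
    by rewrite !dotE (dotC y z); lra.
  by move=> h; rewrite -(ler_pM2l t0); lra.
exists c => y; suff : dot (u k - c) y @[k --> U] --> 0.
  move=> d0; rewrite -[X in _ --> X](addr0 (dot c y)).
  have -> : (fun k => dot (u k) y) = (fun k => dot c y + dot (u k - c) y).
    by apply/funext => k; rewrite dotDl dotNl addrC subrK.
  by apply: cvgD => //; exact: cvg_cst.
apply/cvgr0Pnorm_le => e e0; near=> k; rewrite ler_norml lerNl -dotNr.
by apply/andP; split; near: k; exact: half.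
Unshelve. all: by end_near. Qed.

(** The graph of a maximal monotone operator is not closed for the product of the
    weak topologies, but a limit point belongs to it once the pairings converge
    as well.  For a family of operators, convergence of the total pairing is
    enough, because the product operator is maximal monotone too.  This is proved
    by testing monotonicity against the points [y_i] given by Minty's theorem
    such that [ab_i + pb_i - y_i] belongs to [B_i y_i]: in the limit
    one gets [0 <= - \sum_i |pb_i - y_i|^2]. *)
Lemma maximal_monotone_weak_closed {I : finType} {T : Type} (F : set_system T)
    {FF : ProperFilter F} (B : I -> H -> set H) (p a : T -> I -> H)
    (pb ab : I -> H) :
  (forall i, maximal_monotone dot (B i)) ->
  (forall k i, B i (p k i) (a k i)) ->
  (forall i y, dot (p k i) y @[k --> F] --> dot (pb i) y) ->
  (forall i y, dot (a k i) y @[k --> F] --> dot (ab i) y) ->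
  \sum_i dot (a k i) (p k i) @[k --> F] --> \sum_i dot (ab i) (pb i) ->
  forall i, B i (pb i) (ab i).
Proof.
move=> mB Bpa wp wa ws.
have /choice[y By] : forall i, exists y, B i y (ab i + pb i - y).
  move=> i; have [y By] := minty dot_norm (B i) 1 (ab i + pb i) (mB i) ltr01.
  by exists y; move: By; rewrite invr1 scale1r.
pose v i := ab i + pb i - y i.
have lim : \sum_i dot (a k i) (p k i) - \sum_i dot (a k i) (y i)
    - \sum_i dot (p k i) (v i) + \sum_i dot (v i) (y i) @[k --> F] -->
    \sum_i dot (ab i) (pb i) - \sum_i dot (ab i) (y i)
    - \sum_i dot (pb i) (v i) + \sum_i dot (v i) (y i).
  apply: cvgD; last exact: cvg_cst.
  by apply: cvgB; [apply: cvgB => // |];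
    apply: cvg_big => //; exact: add_continuous.
have : 0 <= \sum_i dot (ab i) (pb i) - \sum_i dot (ab i) (y i)
    - \sum_i dot (pb i) (v i) + \sum_i dot (v i) (y i).
  apply: (cvgr_to_ge lim); near=> k.
  rewrite -!sumrB -big_split/= sumr_ge0// => i _.
  have := (mB i).1 _ _ _ _ (Bpa k i) (By i).
  rewrite -/(v i); move: (v i) => vi; rewrite !dotE (dotC (p k i)); lra.
rewrite -!sumrB -big_split/=.
rewrite (eq_bigr (fun i => - dot (pb i - y i) (pb i - y i))); last first.
  move=> i _; rewrite /v !dotE (dotC (pb i) (ab i)) (dotC (y i) (pb i)); lra.
rewrite sumrN oppr_ge0 => S0 i.
have pby : pb i - y i = 0.
  apply: (dot_eq0 dot_norm); apply: le_trans S0.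
  rewrite (bigD1 i)//= lerDl sumr_ge0// => j _; exact: dot_ge0.
have -> : pb i = y i by apply/eqP; rewrite -subr_eq0 pby.
by have := By i; rewrite -[X in B i _ X]addrA pby addr0.
Unshelve. all: by end_near. Qed.
End WeakLimits.

(** Reduces identities between vectors to identities between numbers. *)
Lemma dot_inj {R : realType} {H : normedModType R} {dot : {dot H for idfun}}
    (dot_norm : forall x : H, dot x x = `|x| ^+ 2) (x y : H) :
  (forall z, dot x z = dot y z) -> x = y.
Proof.
move=> h; apply/eqP; rewrite -subr_eq0; apply/eqP/(dot_eq0 dot_norm).
by rewrite dotDl dotNl h subrr.
Qed.

(** * Sums over consecutive indices *)

Section Indices.
Context {n : nat}.
Implicit Types j : 'I_n.+1.

Lemma idx_pred_lift j : idx_pred j = lift ord_max j.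
Proof. by apply: val_inj; rewrite /= /bump leqNgt ltn_ord. Qed.

Lemma unlift_ord0_idx j : unlift ord0 (idx j) = Some j.
Proof. exact: liftK. Qed.

Lemma unlift_max_idx_pred j : unlift ord_max (idx_pred j) = Some j.
Proof. by rewrite idx_pred_lift liftK. Qed.

Lemma idx_max : idx ord_max = ord_max :> 'I_n.+2.
Proof. exact: val_inj. Qed.

Lemma idx_pred0 : idx_pred ord0 = ord0 :> 'I_n.+2.
Proof. exact: val_inj. Qed.

Lemma idx_ind (P : 'I_n.+2 -> Prop) :
  P ord0 -> (forall j, P (idx_pred j) -> P (idx j)) -> forall i, P i.
Proof.
move=> P0 PS [i]; elim: i => [|i IH] lti.
  by have -> : Ordinal lti = ord0 by exact: val_inj.
have -> : Ordinal lti = idx (Ordinal (lti : (i < n.+1)%N)) by exact: val_inj.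
by apply: PS; have -> : idx_pred (Ordinal (lti : (i < n.+1)%N)) =
  Ordinal (ltnW lti) by exact: val_inj.
Qed.

Lemma sum_idx {V : zmodType} (f : 'I_n.+2 -> V) :
  \sum_i f i = f ord0 + \sum_(j < n.+1) f (idx j).
Proof. exact: big_ord_recl. Qed.

Lemma sum_idx_pred {V : zmodType} (f : 'I_n.+2 -> V) :
  \sum_i f i = f ord_max + \sum_(j < n.+1) f (idx_pred j).
Proof. by rewrite big_ord_recr addrC. Qed.

Lemma telescope_idx {V : zmodType} (f : 'I_n.+2 -> V) :
  \sum_(j < n.+1) (f (idx j) - f (idx_pred j)) = f ord_max - f ord0.
Proof.
rewrite sumrB; apply/eqP; rewrite subr_eq addrAC -sum_idx_pred sum_idx.
by rewrite addrAC subrr add0r.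
Qed.

End Indices.

(** * Resolvents and the inclusion as graph conditions *)

Section Inclusions.
Context {R : realType} {H : completeNormedModType R} {dot : {dot H for idfun}}.
Context (dot_norm : forall x : H, dot x x = `|x| ^+ 2).

Lemma resolvent_graph (A : H -> set H) (g : R) (b : H) :
  maximal_monotone dot A -> 0 < g ->
  A (resolvent (op_scale g A) b) (g^-1 *: (b - resolvent (op_scale g A) b)).
Proof.
move=> mA g0; have [x Ax] := minty dot_norm A g b mA g0.
have : resolvent_op (op_scale g A) b (resolvent (op_scale g A) b).
  apply: (xgetPex 0); exists x, x => //; exists (b - x); last by rewrite subrKC.
  by exists (g^-1 *: (b - x)); rewrite // scalerA mulfV ?gt_eqF// scale1r.
move: (resolvent _ b) => y [_ ->] [_ [a Aa <-]] <-.
by rewrite addrAC subrr add0r scalerA mulVf ?gt_eqF// scale1r.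
Qed.

Lemma big_op_addP m (B : 'I_m -> H -> set H) (z s : H) :
  (\big[op_add/op_zero]_(j < m) B j) z s <->
  exists2 b : 'I_m -> H, forall j, B j z (b j) & \sum_j b j = s.
Proof.
elim: m B s => [|m IH] B s.
  rewrite big_ord0; split=> [-> | [b _ <-]]; last by rewrite big_ord0.
  by exists (fun=> 0) => [[]|]; rewrite // big_ord0.
rewrite big_ord_recl; split=> [[b0 Bb0 [_ /IH[b Bb <-] <-]]|[b Bb <-]].
  exists (fun i => oapp b b0 (unlift ord0 i)) => [i|].
    by case: unliftP => [j|] ->.
  rewrite big_ord_recl unlift_none; congr (_ + _).
  by apply: eq_bigr => j _; rewrite liftK.
rewrite big_ord_recl; exists (b ord0) => //; exists (\sum_j b (lift ord0 j)) => //.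
by apply/IH; exists (fun j => b (lift ord0 j)).
Qed.

Lemma inclusion_solutionP n (A : 'I_n.+2 -> H -> set H) (C : 'I_n.+1 -> H -> H)
    (z : H) : inclusion_solution A C z <->
  exists2 a : 'I_n.+2 -> H, forall i, A i z (a i) &
    \sum_i a i + \sum_j C j z = 0.
Proof.
split=> [[a0 Aa0 [_ /big_op_addP[b Bb <-] s0]]|[a Aa s0]].
  exists (fun i => oapp (fun j => b j - C j z) a0 (unlift ord0 i)) => [i|].
    by case: unliftP => [j|] ->//=; have [u Au [_ -> <-]] := Bb j; rewrite addrK.
  rewrite sum_idx unlift_none /= -addrA -big_split/= -[RHS]s0; congr (_ + _).
  by apply: eq_bigr => j _; rewrite unlift_ord0_idx/= subrK.
exists (a ord0) => //; exists (\sum_j (a (idx j) + C j z)).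
  apply/big_op_addP; exists (fun j => a (idx j) + C j z) => // j.
  by exists (a (idx j)) => //; exists (C j z).
by rewrite big_split/= addrA -sum_idx.
Qed.

End Inclusions.

(** * The algebra of one sweep *)

Section Scheme.
Context {R : realType} {H : completeNormedModType R} {dot : {dot H for idfun}}.
Context (dot_norm : forall x : H, dot x x = `|x| ^+ 2).
Context {n : nat} (beta : R) (beta_gt0 : 0 < beta).
Context (A : 'I_n.+2 -> H -> set H) (C : 'I_n.+1 -> H -> H).
Context (A_maxmono : forall i, maximal_monotone dot (A i)).
Context (C_coco : forall i, cocoercive dot beta^-1 (C i)).
Context (gamma : R) (gamma_gt0 : 0 < gamma).
Implicit Types (w c : 'I_n.+1 -> H) (x : 'I_n.+2 -> H).

Definition residual x (j : 'I_n.+1) : H := x (idx j) - x (idx_pred j).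

(** [gamma] times the element of [A_i x_i] produced by a sweep:
    [w_{i+1} - w_i + 2 (x_{i-1} - x_i) - gamma c_i] for [0 < i < N].  The same
    formula covers the two extreme indices with the conventions [w_0 = x_0],
    [w_{N+1} = x_N], [x_{-1} = x_0] and [c_0 = 0]; these are encoded by [oapp],
    whose default value is taken at an index without a predecessor (for [ord0])
    or without a successor (for [ord_max]). *)
Definition dual w x c (i : 'I_n.+2) : H :=
  oapp w (x i) (unlift ord_max i) - oapp w (x i) (unlift ord0 i)
  + oapp (fun j => - (2 *: residual x j) - gamma *: c j) 0 (unlift ord0 i).

Definition forward x (j : 'I_n.+1) : H := C j (x (idx_pred j)).

(** The relation between the input [w] and the output [x] of a sweep, freed of
    the resolvents; fixed points of the scheme are the states with [x] constant. *)
Definition sfdr_state w x : Prop :=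
  forall i, A i (x i) (gamma^-1 *: dual w x (forward x) i).

Lemma dualB w x c w' x' c' i : dual w x c i - dual w' x' c' i =
  dual (fun j => w j - w' j) (fun i => x i - x' i) (fun j => c j - c' j) i.
Proof.
apply: (dot_inj dot_norm) => z.
rewrite /dual /residual; case: unliftP => [j|] ->; case: unliftP => [j'|] _ /=;
  rewrite !dotE; ring.
Qed.

Lemma dual_ord0 w x c : dual w x c ord0 = w ord0 - x ord0.
Proof.
rewrite /dual -[X in unlift ord_max X]idx_pred0 unlift_max_idx_pred/=.
by rewrite unlift_none/= addr0.
Qed.

(** Summation by parts.  The terms [<w_{i+1} - w_i, x_i>] contribute
    [- <w, r> + |x_N|^2 - |x_0|^2], and the boundary terms are cancelled by
    [- 2 <r_i, x_i> = |x_{i-1}|^2 - |x_i|^2 - |r_i|^2].  The [C_i] are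
    paired with the points [x_{i-1}] at which they are evaluated, the remainder
    [<c_i, r_i>] being moved to the right-hand side. *)
Lemma dual_energy w x c :
  \sum_i dot (dual w x c i) (x i) + gamma * \sum_j dot (c j) (x (idx_pred j)) =
  - \sum_j (dot (w j) (residual x j) + dot (residual x j) (residual x j)
            + gamma * dot (c j) (residual x j)).
Proof.
pose f i := dot (x i) (x i).
have -> : \sum_i dot (dual w x c i) (x i) =
    \sum_i dot (oapp w (x i) (unlift ord_max i)) (x i)
    - \sum_i dot (oapp w (x i) (unlift ord0 i)) (x i)
    + \sum_i dot (oapp (fun j => - (2 *: residual x j) - gamma *: c j) 0
        (unlift ord0 i)) (x i).
  by rewrite -sumrB -big_split/=; apply: eq_bigr => i _; rewrite !dotE.
rewrite (sum_idx_pred (fun i => dot (oapp w (x i) (unlift ord_max i)) (x i))).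
rewrite (sum_idx (fun i => dot (oapp w (x i) (unlift ord0 i)) (x i))).
rewrite (sum_idx (fun i => dot (oapp _ 0 (unlift ord0 i)) (x i))).
rewrite !unlift_none/= dot0l add0r.
under eq_bigr do rewrite unlift_max_idx_pred/=.
under [X in _ - (_ + X)]eq_bigr do rewrite unlift_ord0_idx/=.
under [X in _ + X + _]eq_bigr do rewrite unlift_ord0_idx/=.
have T := telescope_idx f.
rewrite (_ : _ - _ + _ = (f ord_max - f ord0)
    + (\sum_j dot (w j) (x (idx_pred j)) - \sum_j dot (w j) (x (idx j)))
    + \sum_j dot (- (2 *: residual x j) - gamma *: c j) (x (idx j))); last first.
  by rewrite /f; ring.
rewrite -T mulr_sumr -sumrB -!big_split/= -sumrN; apply: eq_bigr => j _.
rewrite /f /residual; move: (x (idx j)) (x (idx_pred j)) => a b.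
rewrite !dotE (dotC b a); ring.
Qed.

Lemma dual_sum w x c :
  \sum_i dual w x c i + gamma *: \sum_j c j = x ord0 - x ord_max.
Proof.
have T : \sum_j residual x j = _ := telescope_idx x.
apply: (dot_inj dot_norm) => z.
rewrite /dual !big_split/= sumrN.
rewrite (sum_idx_pred (fun i => oapp w (x i) (unlift ord_max i))).
rewrite (sum_idx (fun i => oapp w (x i) (unlift ord0 i))).
rewrite (sum_idx (fun i => oapp _ 0 (unlift ord0 i))).
rewrite !unlift_none/=.
under eq_bigr do rewrite unlift_max_idx_pred/=.
under [X in _ - (_ + X)]eq_bigr do rewrite unlift_ord0_idx/=.
under [X in _ + (0 + X) + _]eq_bigr do rewrite unlift_ord0_idx/=.
rewrite sumrB sumrN -!scaler_sumr T !dotE; ring.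
Qed.

Lemma sfdr_step_state theta w w' x :
  sfdr_step A C gamma theta w w' x -> sfdr_state w x.
Proof.
move=> [x0 xmid xmax _] i.
case: (unliftP ord0 i) => [j|] ->; last first.
  rewrite dual_ord0 x0.
  by apply: resolvent_graph.
rewrite /dual unlift_ord0_idx /=; case: (unliftP ord_max j) => [j' jE|->]; last first.
  rewrite -/(idx _) idx_max unlift_none/=.
  rewrite [X in A _ X _]xmax.
  have := resolvent_graph dot_norm (A ord_max) gamma
    (2 *: x (idx_pred ord_max) - w ord_max
     - gamma *: C ord_max (x (idx_pred ord_max))) (A_maxmono _) gamma_gt0.
  rewrite -xmax; congr (A _ _ _); congr (_ *: _).
  apply: (dot_inj dot_norm) => z.
  by rewrite /residual /forward idx_max !dotE; ring.
have {}jE : j = widen_ord (leqnSn n) j'.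
  by apply: val_inj; rewrite jE /= /bump leqNgt ltn_ord.
have -> : unlift ord_max (lift ord0 j) = Some (lift ord0 j').
  rewrite -(unlift_max_idx_pred (lift ord0 j')); congr unlift.
  by apply: val_inj; rewrite jE.
have g2 : 0 < gamma / 2 by rewrite divr_gt0.
have := resolvent_graph dot_norm (A (idx j)) (gamma / 2)
  (x (idx_pred j) + 2^-1 *: (w (lift ord0 j') - w j)
   - (gamma / 2) *: C j (x (idx_pred j))) (A_maxmono _) g2.
have -> : resolvent (op_scale (gamma / 2) (A (idx j)))
  (x (idx_pred j) + 2^-1 *: (w (lift ord0 j') - w j)
   - (gamma / 2) *: C j (x (idx_pred j))) = x (idx j) by rewrite jE xmid.
congr (A _ _ _); apply: (dot_inj dot_norm) => z.
rewrite /residual /forward /= !dotE; field.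
by rewrite gt_eqF.
Qed.

(** Cocoercivity enters through
    [- <dc, dx_{i-1}> - <dc, dr> <= - |dc|^2 / beta - <dc, dr>
     <= beta / 4 |dr|^2],
    which is where the constant [2 - gamma beta / 2] comes from. *)
Lemma sfdr_state_monotone w x w' x' : sfdr_state w x -> sfdr_state w' x' ->
  let dr j := residual x j - residual x' j in
  2 * \sum_j dot (w j - w' j) (dr j)
  + (2 - gamma * beta / 2) * \sum_j dot (dr j) (dr j) <= 0.
Proof.
move=> sx sx' /=.
pose dw j := w j - w' j; pose dx i := x i - x' i.
pose dc j := forward x j - forward x' j.
have drE j : residual x j - residual x' j = residual dx j.
  by apply: (dot_inj dot_norm) => z; rewrite /residual /dx !dotE; ring.
under eq_bigr do rewrite drE -/(dw _).
under [X in _ + _ * X]eq_bigr do rewrite drE.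
have : 0 <= \sum_i dot (dual dw dx dc i) (dx i).
  apply: sumr_ge0 => i _.
  have := (A_maxmono i).1 _ _ _ _ (sx i) (sx' i).
  by rewrite -scalerBr dualB dotZl pmulr_rge0 ?invr_gt0.
have := dual_energy dw dx dc.
have : \sum_j (beta^-1 * dot (dc j) (dc j)) <=
    \sum_j dot (dc j) (dx (idx_pred j)).
  by apply: ler_sum => j _; rewrite dot_norm; exact: C_coco.
have : \sum_j - dot (dc j) (residual dx j) <= \sum_j (
    beta^-1 * dot (dc j) (dc j) +
    beta / 4 * dot (residual dx j) (residual dx j)).
  apply: ler_sum => j _.
  move: (residual dx j) (dc j) => u v.
  have := dot_ge0 dot_norm (v + (beta / 2) *: u).
  rewrite !dotE (dotC u) -(@pmulr_rge0 _ beta^-1) ?invr_gt0//.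
  move: (dot v v) (dot v u) (dot u u) => a b d.
  have -> : beta^-1 *
        (a + beta / 2 * b + (beta / 2 * b + beta / 2 * (beta / 2 * d))) =
      beta^-1 * a + b + beta / 4 * d by field; rewrite gt_eqF.
  lra.
rewrite !big_split/= -!mulr_sumr sumrN.
move: (\sum_j dot (dc j) (dc j)) (\sum_j dot (dc j) (residual _ j)) => p q.
move: (\sum_j dot (dc j) _) (\sum_j dot (residual _ j) _) => s d.
move: (\sum_j dot (dw j) _) (\sum_i dot (dual _ _ _ i) _) => e f.
move=> h1 h2 h3 h4.
have {}h1 : gamma * (- q) <= gamma * (beta^-1 * p + beta / 4 * d).
  by rewrite ler_pM2l.
have {}h2 : gamma * (beta^-1 * p) <= gamma * s by rewrite ler_pM2l.
lra.
Qed.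

End Scheme.

(** * Fixed points of the scheme *)

Section Convergence.
Context {R : realType} {H : completeNormedModType R} {dot : {dot H for idfun}}.
Context (dot_norm : forall x : H, dot x x = `|x| ^+ 2).
Context {n : nat} (beta : R) (beta_gt0 : 0 < beta).
Context (A : 'I_n.+2 -> H -> set H) (C : 'I_n.+1 -> H -> H).
Context (A_maxmono : forall i, maximal_monotone dot (A i)).
Context (C_maxmono : forall i, maximal_monotone dot (op_of_fun (C i))).
Context (C_coco : forall i, cocoercive dot beta^-1 (C i)).
Context (gamma : R) (gamma_gt0 : 0 < gamma) (gamma_lt : gamma < 4 / beta).

Local Notation state := (sfdr_state A C gamma).
Local Notation L := (2 - gamma * beta / 2).

Lemma max_relaxation_gt0 : 0 < L.
Proof. by move: gamma_lt; rewrite ltr_pdivlMr//; lra. Qed.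

Lemma residual_cst (z : H) j : residual (fun _ : 'I_n.+2 => z) j = 0.
Proof. by rewrite /residual subrr. Qed.

(** From a solution, [w] is recovered by summing the increments that the
    dual variables must have; the sum over all indices vanishes because [z] is a
    solution, which gives the last of the [N + 1] conditions. *)
Lemma inclusion_state z :
  inclusion_solution A C z <-> exists w, state w (fun=> z).
Proof.
split=> [/inclusion_solutionP[a Aa s0]|[w sw]].
  pose b i := a i + oapp (fun j => C j z) 0 (unlift ord0 i).
  pose S m := \sum_(i < n.+2 | (i < m)%N) b i.
  have S0 : S 0%N = 0 by rewrite /S big_pred0.
  have Smax : S n.+2 = 0.
    rewrite /S; under eq_bigl do rewrite ltn_ord.
    rewrite big_split/= [X in _ + X]sum_idx unlift_none/= add0r -[RHS]s0.
    by congr (_ + _); apply: eq_bigr => j _; rewrite unlift_ord0_idx.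
  have SS (i : 'I_n.+2) : S i.+1 = b i + S i.
    rewrite /S (bigD1 i)//=; congr (_ + _); apply: eq_bigl => j.
    by rewrite ltnS andbC -val_eqE/= -ltn_neqAle.
  exists (fun j : 'I_n.+1 => z + gamma *: S j.+1) => i.
  suff -> : dual gamma (fun j : 'I_n.+1 => z + gamma *: S j.+1) (fun=> z)
      (forward C (fun=> z)) i = gamma *: a i.
    by rewrite scalerA mulVf ?gt_eqF// scale1r.
  have -> : gamma *: a i = gamma *: (S i.+1 - S i)
      - gamma *: oapp (fun j => C j z) 0 (unlift ord0 i).
    by rewrite SS addrK -scalerBr addrK.
  rewrite /dual; apply: (dot_inj dot_norm) => y.
  have -> : oapp (fun j : 'I_n.+1 => z + gamma *: S j.+1) z (unlift ord_max i)
      = z + gamma *: S i.+1.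
    case: unliftP => [j|] -> /=; first by rewrite /bump leqNgt ltn_ord.
    by rewrite Smax scaler0 addr0.
  by case: unliftP => [j|] -> /=; rewrite ?S0 ?residual_cst !dotE; ring.
apply/inclusion_solutionP.
exists (fun i => gamma^-1 *: dual gamma w (fun=> z) (forward C (fun=> z)) i) => //.
rewrite -scaler_sumr.
have := dual_sum dot_norm gamma w (fun=> z) (forward C (fun=> z)).
rewrite subrr => /eqP; rewrite addr_eq0 => /eqP ->.
by rewrite scalerN scalerA mulVf ?gt_eqF// scale1r addNr.
Qed.

(** Nonexpansiveness of the resolvent of [gamma A_0]. *)
Lemma state_x0_nonexpansive {w x w' x'} : state w x -> state w' x' ->
  dot (x ord0 - x' ord0) (x ord0 - x' ord0) <=
  dot (w ord0 - w' ord0) (w ord0 - w' ord0).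
Proof.
move=> /(_ ord0) sx /(_ ord0) sx'; rewrite !dual_ord0 in sx sx'.
have := (A_maxmono ord0).1 _ _ _ _ sx sx'.
rewrite -scalerBr dotZl pmulr_rge0 ?invr_gt0//.
have := dot_ge0 dot_norm ((w ord0 - w' ord0) - (x ord0 - x' ord0)).
have -> : w ord0 - x ord0 - (w' ord0 - x' ord0) =
  (w ord0 - w' ord0) - (x ord0 - x' ord0).
  by apply: (dot_inj dot_norm) => z; rewrite !dotE; ring.
move: (w ord0 - _) (x ord0 - _) => a b; rewrite !dotE (dotC b a); lra.
Qed.

Lemma state_resolvent {w x} : state w x ->
  resolvent (op_scale gamma (A ord0)) (w ord0) = x ord0.
Proof.
move=> /(_ ord0); rewrite dual_ord0 => Ax.
have Ay := resolvent_graph dot_norm (A ord0) gamma (w ord0) (A_maxmono ord0)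
  gamma_gt0.
move: (resolvent _ _) Ay => y Ay.
apply/eqP; rewrite -subr_eq0; apply/eqP/(dot_eq0 dot_norm).
have := (A_maxmono ord0).1 _ _ _ _ Ay Ax.
rewrite -scalerBr dotZl pmulr_rge0 ?invr_gt0//.
have -> : w ord0 - y - (w ord0 - x ord0) = - (y - x ord0).
  by apply: (dot_inj dot_norm) => z; rewrite !dotE; ring.
by rewrite dotNl oppr_ge0.
Qed.

(** * Asymptotic behaviour of the iteration *)

Section Iteration.
Context (theta : nat -> R) (theta_bound : forall k, 0 <= theta k <= L).
Context (theta_sum : \sum_(0 <= k < m) theta k * (L - theta k)
                 @[m --> \oo] --> +oo).
Context (w : nat -> 'I_n.+1 -> H) (x : nat -> 'I_n.+2 -> H).
Context (w_x : forall k, state (w k) (x k)).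
Context (w_step : forall k i, w k.+1 i = w k i + theta k *: residual (x k) i).

Definition energy k := \sum_j dot (residual (x k) j) (residual (x k) j).
Definition distance ws k := \sum_j dot (w k j - ws j) (w k j - ws j).

Lemma energy_ge0 k : 0 <= energy k.
Proof. by apply: sumr_ge0 => j _; exact: dot_ge0. Qed.

Lemma distance_ge0 ws k : 0 <= distance ws k.
Proof. by apply: sumr_ge0 => j _; exact: dot_ge0. Qed.

Lemma distance_step {ws z} k : state ws (fun=> z) ->
  distance ws k.+1 <= distance ws k - theta k * (L - theta k) * energy k.
Proof.
move=> sz; have /= := sfdr_state_monotone dot_norm beta beta_gt0 A C A_maxmono
  C_coco gamma gamma_gt0 _ _ _ _ (w_x k) sz.
under eq_bigr do rewrite residual_cst subr0.
under [X in _ + _ * X]eq_bigr do rewrite residual_cst subr0.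
rewrite -/(energy k) => h.
have -> : distance ws k.+1 = distance ws k + theta k ^+ 2 * energy k
    + theta k * (2 * \sum_j dot (w k j - ws j) (residual (x k) j)).
  rewrite /distance /energy !mulr_sumr -!big_split/=; apply: eq_bigr => j _.
  have -> : w k.+1 j - ws j = (w k j - ws j) + theta k *: residual (x k) j.
    by rewrite w_step addrAC.
  move: (w k j - ws j) (residual _ j) => a b.
  by rewrite !dotE (dotC b a); ring.
have /andP[t0 _] := theta_bound k.
move: (ler_wpM2l t0 h); lra.
Qed.

(** [sfdr_state_monotone] for two consecutive states, where
    [dw = theta_k r^k].  If [theta_k] vanishes it gives [dr = 0] instead. *)
Lemma energy_step k : energy k.+1 <= energy k.
Proof.
have /= := sfdr_state_monotone dot_norm beta beta_gt0 A C A_maxmono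
  C_coco gamma gamma_gt0 _ _ _ _ (w_x k.+1) (w_x k).
under eq_bigr do rewrite w_step [_ + _ - _]addrAC subrr add0r dotZl.
rewrite -mulr_sumr.
pose d j := residual (x k.+1) j - residual (x k) j.
rewrite -[X in _ + _ * X]/(\sum_j dot (d j) (d j)).
have -> : energy k.+1 = energy k + \sum_j dot (d j) (d j)
    + 2 * \sum_j dot (residual (x k) j) (d j).
  rewrite /energy mulr_sumr -!big_split/=; apply: eq_bigr => j _; rewrite /d.
  move: (residual (x k.+1) j) (residual (x k) j) => a b.
  by rewrite !dotE (dotC b a); ring.
have : 0 <= \sum_j dot (d j) (d j) by apply: sumr_ge0 => j _; exact: dot_ge0.
have /andP[t0 tL] := theta_bound k.
rewrite -[X in _ * (_ * X)]/(\sum_j dot (residual (x k) j) (d j)).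
have [tpos|t00] := ltrP 0 (theta k).
  move: (\sum_j dot (d j) (d j)) (\sum_j dot (residual (x k) j) (d j)) => D S D0.
  move=> h; have : 2 * (theta k * S) + theta k * D <= 0.
    by apply: le_trans h; rewrite lerD2l ler_wpM2r.
  rewrite mulrCA -mulrDr pmulr_rle0//; lra.
have -> : theta k = 0 by apply/eqP; rewrite eq_le t0 t00.
rewrite mul0r mulr0 add0r pmulr_rle0 ?max_relaxation_gt0// => D0 D1.
have D00 : \sum_j dot (d j) (d j) = 0 by apply/eqP; rewrite eq_le D0 D1.
rewrite D00 big1 => [|j _]; first by rewrite mulr0 !addr0.
have -> : d j = 0; last by rewrite dot0r.
apply: (dot_eq0 dot_norm); rewrite -D00 (bigD1 j)//= lerDl.
by apply: sumr_ge0 => i _; exact: dot_ge0.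
Qed.

Lemma energy_le {k l} : (k <= l)%N -> energy l <= energy k.
Proof.
move=> /subnK <-; elim: (l - k)%N => // m IH; rewrite addSn.
exact: le_trans (energy_step _) IH.
Qed.

Lemma distance_le {ws z} k :
  state ws (fun=> z) -> distance ws k.+1 <= distance ws k.
Proof.
move=> sz; apply: le_trans (distance_step k sz) _.
rewrite lerBlDr lerDl mulr_ge0 ?energy_ge0//.
by have /andP[t0 tL] := theta_bound k; rewrite mulr_ge0// subr_ge0.
Qed.

(** The gains in [distance_step] have a bounded sum, so the energy cannot stay
    above a positive constant, and it does not increase. *)
Lemma energy_cvg0 {ws z} : state ws (fun=> z) -> energy @ \oo --> 0.
Proof.
move=> sz; apply/cvgr0Pnorm_le => e e0.
suff [k ke] : exists k, energy k <= e.
  exists k => // l /= kl; rewrite ger0_norm ?energy_ge0//.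
  exact: le_trans (energy_le kl) ke.
apply: contrapT => nk.
have big k : e < energy k by rewrite ltNge; apply/negP => ke; apply: nk; exists k.
have sum_le m : e * \sum_(0 <= k < m) theta k * (L - theta k) <=
    distance ws 0 - distance ws m.
  elim: m => [|m IH]; first by rewrite big_nil mulr0 subrr.
  rewrite big_nat_recr//= mulrDr.
  have := distance_step m sz.
  have : theta m * (L - theta m) * e <= theta m * (L - theta m) * energy m.
    have /andP[t0 tL] := theta_bound m.
    by apply: ler_wpM2l; [rewrite mulr_ge0// subr_ge0 | exact: ltW].
  move: IH; lra.
have /cvgryPgt/(_ (distance ws 0 / e))/filter_ex[m] := theta_sum.
rewrite ltr_pdivrMr// => lt_m; have := sum_le m; have := distance_ge0 ws m.
move: lt_m; lra.
Qed.

Lemma residual_cvg0 {ws z} j : state ws (fun=> z) ->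
  `|residual (x k) j| @[k --> \oo] --> 0.
Proof.
move=> /energy_cvg0 E0; apply/cvgr0Pnorm_lt => e e0.
have e2 : 0 < e ^+ 2 by rewrite exprn_gt0.
near=> k; rewrite normr_id -(@ltr_pXn2r _ 2)// ?nnegrE ?(ltW e0)//.
apply: (@le_lt_trans _ _ (energy k)).
  rewrite -dot_norm /energy (bigD1 j)//= lerDl sumr_ge0// => i _.
  exact: dot_ge0.
by near: k; exact: (cvgr_lt 0 E0).
Unshelve. all: by end_near. Qed.

Lemma residual_bounded j : exists M, forall k, `|residual (x k) j| <= M.
Proof.
exists (energy 0 + 1) => k.
have : `|residual (x k) j| ^+ 2 <= energy 0.
  apply: le_trans (energy_le (leq0n k)).
  rewrite -dot_norm /energy (bigD1 j)//= lerDl sumr_ge0// => i _.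
  exact: dot_ge0.
have := normr_ge0 (residual (x k) j); nra.
Qed.

Lemma w_bounded {ws z} j :
  state ws (fun=> z) -> exists M, forall k, `|w k j| <= M.
Proof.
move=> sz; exists (`|ws j| + (distance ws 0 + 1)) => k.
rewrite -[w k j](subrKC (ws j)) (le_trans (ler_normD _ _))// lerD2l.
have : `|w k j - ws j| ^+ 2 <= distance ws 0.
  apply: (@le_trans _ _ (distance ws k)).
    rewrite -dot_norm /distance (bigD1 j)//= lerDl sumr_ge0// => i _.
    exact: dot_ge0.
  by elim: k => // k; apply: le_trans; exact: distance_le sz.
have := normr_ge0 (w k j - ws j); nra.
Qed.

Lemma x_bounded {ws z} i :
  state ws (fun=> z) -> exists M, forall k, `|x k i| <= M.
Proof.
move=> sz; move: i; apply: idx_ind => [|j [M xM]].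
  have [M wM] := w_bounded ord0 sz.
  exists (`|z| + (M + `|ws ord0|)) => k.
  rewrite -[x k ord0](subrKC z) (le_trans (ler_normD _ _))// lerD2l.
  apply: (@le_trans _ _ `|w k ord0 - ws ord0|); last first.
    by rewrite (le_trans (ler_normB _ _))// lerD2r.
  rewrite -(@ler_pXn2r _ 2)// ?nnegrE// -!dot_norm.
  exact: state_x0_nonexpansive (w_x k) sz.
have [M' rM] := residual_bounded j; exists (M + M') => k.
rewrite -(subrKC (x k (idx_pred j)) (x k (idx j))).
rewrite (le_trans (ler_normD _ _))//; apply: lerD; [exact: xM | exact: rM].
Qed.

Lemma forward_bounded {ws z} j : state ws (fun=> z) ->
  exists M, forall k, `|forward C (x k) j| <= M.
Proof.
move=> /(x_bounded (idx_pred j))[M xM].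
exists (`|C j z| + beta * (M + `|z|)) => k; rewrite /forward.
move: (x k _) (xM k) => y yM.
rewrite -[C j y](subrKC (C j z)) (le_trans (ler_normD _ _))// lerD2l.
have [->|C0] := eqVneq (C j y - C j z) 0.
  by rewrite normr0 mulr_ge0 ?(ltW beta_gt0)// addr_ge0// (le_trans _ yM).
have Cp : 0 < `|C j y - C j z| by rewrite normr_gt0.
have := le_trans (C_coco j y z)
  (le_trans (ler_norm _) (dot_CauchySchwarz dot_norm _ _)).
rewrite expr2 mulrCA ler_pM2l// ler_pdivrMl// => /le_trans; apply.
by rewrite ler_pM2l// (le_trans (ler_normB _ _))// lerD2r.
Qed.

(** The [x_i^k] share their weak limit because the residuals tend to [0].  The
    operators [A_i] and [C_i] are treated as one family of maximal
    monotone operators, for which [dual_energy] computes the total pairing: each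
    of its terms contains a residual and a bounded factor, so it tends to [0],
    which is also its value at the limit. *)
Lemma ultrafilter_cluster {ws0 z0} (U : set_system nat) {UU : UltraFilter U} :
  state ws0 (fun=> z0) -> \oo `<=` U ->
  exists ws z, [/\ state ws (fun=> z),
    forall j y, dot (w k j) y @[k --> U] --> dot (ws j) y &
    forall i y, dot (x k i) y @[k --> U] --> dot z y].
Proof.
move=> sz oU.
have /choice[ws wlim] : forall j, exists l, forall y,
    dot (w k j) y @[k --> U] --> dot l y.
  by move=> j; have [M wM] := w_bounded j sz; exact: (bounded_weak_limit dot_norm U).
have /choice[c clim] : forall j, exists l, forall y,
    dot (forward C (x k) j) y @[k --> U] --> dot l y.
  move=> j; have [M cM] := forward_bounded j sz.
  exact: (bounded_weak_limit dot_norm U).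
have r0 j : `|residual (x k) j| @[k --> U] --> 0.
  by apply: cvg_trans (residual_cvg0 j sz) => B; exact: oU.
have [z xlim] : exists z, forall i y, dot (x k i) y @[k --> U] --> dot z y.
  have [M xM] := x_bounded ord0 sz.
  have [z zlim] := bounded_weak_limit dot_norm U (fun k => x k ord0) M xM.
  exists z; apply: idx_ind => [//|j IH y].
  rewrite -[X in _ --> X]addr0.
  have -> : (fun k => dot (x k (idx j)) y) =
      (fun k => dot (x k (idx_pred j)) y + dot (residual (x k) j) y).
    by apply/funext => k; rewrite -dotDl subrKC.
  apply: cvgD; first exact: IH.
  by apply: (dot_cvg0 dot_norm _ (fun=> y) `|y|).
pose B (s : 'I_n.+2 + 'I_n.+1) : H -> set H :=
  match s with inl i => A i | inr j => op_of_fun (C j) end.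
pose p k (s : 'I_n.+2 + 'I_n.+1) : H :=
  match s with inl i => x k i | inr j => x k (idx_pred j) end.
pose a k (s : 'I_n.+2 + 'I_n.+1) : H :=
  match s with inl i => gamma^-1 *: dual gamma (w k) (x k) (forward C (x k)) i
             | inr j => forward C (x k) j end.
pose ab (s : 'I_n.+2 + 'I_n.+1) : H :=
  match s with inl i => gamma^-1 *: dual gamma ws (fun=> z) c i
             | inr j => c j end.
have closed s : B s z (ab s).
  apply: (maximal_monotone_weak_closed dot_norm U B p a (fun=> z) ab).
  - by case.
  - by move=> k [i|j]; [exact: w_x|].
  - by case=> [i|j] y; exact: xlim.
  - case=> [i|j] y /=; last exact: clim.
    rewrite dotZl /dual 2!dotDl dotNl.
    have -> : (fun k =>
        dot (gamma^-1 *: dual gamma (w k) (x k) (forward C (x k)) i) y) =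
      (fun k => gamma^-1 * (dot (oapp (w k) (x k i) (unlift ord_max i)) y
        - dot (oapp (w k) (x k i) (unlift ord0 i)) y
        + dot (oapp (fun j =>
            - (2 *: residual (x k) j) - gamma *: forward C (x k) j)
            0 (unlift ord0 i)) y)).
      by apply/funext => k; rewrite dotZl /dual 2!dotDl dotNl.
    apply: cvgM; first exact: cvg_cst.
    apply: cvgD; first apply: cvgB;
      try by case: unliftP => [j|] _; [exact: wlim | exact: xlim].
    case: unliftP => [j|] _ /=; last exact: cvg_cst.
    rewrite residual_cst scaler0 oppr0 add0r dotNl dotZl -[X in _ --> X]add0r.
    have -> : (fun k =>
        dot (- (2 *: residual (x k) j) - gamma *: forward C (x k) j) y) =
      (fun k => (-2) * dot (residual (x k) j) y
        - gamma * dot (forward C (x k) j) y).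
      by apply/funext => k; rewrite !(dotE, mulNr).
    apply: cvgB; last by apply: cvgM; [exact: cvg_cst | exact: clim].
    rewrite -(mulr0 (-2)); apply: cvgM; first exact: cvg_cst.
    exact: (dot_cvg0 dot_norm _ (fun=> y) `|y|).
  - have pairing (u : 'I_n.+1 -> H) y b :
        \sum_i dot (gamma^-1 *: dual gamma u y b i) (y i)
        + \sum_j dot (b j) (y (idx_pred j)) =
      - gamma^-1 * \sum_j (dot (residual y j) (u j) +
          dot (residual y j) (residual y j) + gamma * dot (residual y j) (b j)).
      under eq_bigr do rewrite dotZl.
      under [in RHS]eq_bigr do
        rewrite (dotC _ (u _)) (dotC (residual _ _) (b _)).
      by rewrite -mulr_sumr mulNr -mulrN -dual_energy; field; rewrite gt_eqF.
    have -> : (fun k => \sum_s dot (a k s) (p k s)) =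
      (fun k => - gamma^-1 * \sum_j (dot (residual (x k) j) (w k j) +
        dot (residual (x k) j) (residual (x k) j)
        + gamma * dot (residual (x k) j) (forward C (x k) j))).
      by apply/funext => k; rewrite -pairing big_sumType.
    have -> : \sum_s dot (ab s) z =
      - gamma^-1 * \sum_(j < n.+1) (0 + 0 + gamma * 0).
      rewrite big_sumType/= (pairing ws (fun=> z) c); congr (_ * _).
      by apply: eq_bigr => j _; rewrite residual_cst !dot0l.
    apply: cvgM; first exact: cvg_cst.
    apply: cvg_big => [|j _]; first exact: add_continuous.
    have [Mw wM] := w_bounded j sz; have [Mc cM] := forward_bounded j sz.
    have [Mr rM] := residual_bounded j.
    apply: cvgD; [apply: cvgD | apply: cvgM; first exact: cvg_cst].
    - exact: (dot_cvg0 dot_norm _ _ Mw).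
    - exact: (dot_cvg0 dot_norm _ _ Mr).
    - exact: (dot_cvg0 dot_norm _ _ Mc).
exists ws, z; split => // i.
have -> : forward C (fun=> z) = c by apply/funext => j; exact/esym/(closed (inr j)).
exact: (closed (inl i)).
Qed.

(** Opial's argument: the difference of the squared distances to two fixed points
    [ws] and [ws'] converges, and it is affine in [w^k], so
    [<w^k, ws - ws'>] converges; comparing its limits along [U] and [U'] gives
    [|ws - ws'|^2 = 0]. *)
Lemma weak_limit_unique ws z ws' z' (U U' : set_system nat) :
  ProperFilter U -> ProperFilter U' -> \oo `<=` U -> \oo `<=` U' ->
  state ws (fun=> z) -> state ws' (fun=> z') ->
  (forall j y, dot (w k j) y @[k --> U] --> dot (ws j) y) ->
  (forall j y, dot (w k j) y @[k --> U'] --> dot (ws' j) y) ->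
  ws = ws' /\ z = z'.
Proof.
move=> FU FU' oU oU' sz sz' wU wU'.
have dcvg ws1 z1 : state ws1 (fun=> z1) -> cvgn (distance ws1).
  move=> s1; apply: nonincreasing_is_cvgn.
    apply/nonincreasing_seqP => k; exact: distance_le s1.
  by exists 0 => _ [k _ <-]; exact: distance_ge0.
pose d j := ws j - ws' j.
have [l lim] : exists l : R, \sum_j dot (w k j) (d j) @[k --> \oo] --> l.
  have /cvg_ex[l1 l1P] := dcvg _ _ sz; have /cvg_ex[l2 l2P] := dcvg _ _ sz'.
  pose K := \sum_j (dot (ws' j) (ws' j) - dot (ws j) (ws j)).
  exists (2^-1 * (l2 - l1 - K)).
  have -> : (fun k => \sum_j dot (w k j) (d j)) =
      (fun k => 2^-1 * (distance ws' k - distance ws k - K)).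
    apply/funext => k; rewrite /distance /K -!sumrB mulr_sumr.
    apply: eq_bigr => j _; rewrite /d.
    by rewrite !dotE (dotC (ws' j)) (dotC (ws j) (w k j)); field.
  apply: cvgM; first exact: cvg_cst.
  by apply: cvgB; [exact: cvgB | exact: cvg_cst].
have E : \sum_j dot (d j) (d j) = 0.
  have lU : \sum_j dot (w k j) (d j) @[k --> U] --> \sum_j dot (ws j) (d j).
    by apply: cvg_big => //; exact: add_continuous.
  have lU' : \sum_j dot (w k j) (d j) @[k --> U'] --> \sum_j dot (ws' j) (d j).
    by apply: cvg_big => //; exact: add_continuous.
  have lE : \sum_j dot (ws j) (d j) = l.
    by apply: (cvg_unique (@Rhausdorff R) lU); apply: cvg_trans lim => B; exact: oU.
  have lE' : \sum_j dot (ws' j) (d j) = l.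
    by apply: (cvg_unique (@Rhausdorff R) lU'); apply: cvg_trans lim => B; exact: oU'.
  under eq_bigr do rewrite [X in dot X]/d dotDl dotNl.
  by rewrite sumrB lE lE' subrr.
have wsE : ws = ws'.
  apply/funext => j; apply/eqP; rewrite -subr_eq0; apply/eqP.
  apply: (dot_eq0 dot_norm); rewrite -E (bigD1 j)//= lerDl.
  by apply: sumr_ge0 => i _; exact: dot_ge0.
split=> //; apply/eqP; rewrite -subr_eq0; apply/eqP/(dot_eq0 dot_norm).
by have := state_x0_nonexpansive sz sz'; rewrite wsE subrr dot0l.
Qed.

Lemma iteration_weak_cvg {ws0 z0} : state ws0 (fun=> z0) ->
  exists ws z, [/\ state ws (fun=> z),
    forall j y, dot (w k j) y @[k --> \oo] --> dot (ws j) y &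
    forall i y, dot (x k i) y @[k --> \oo] --> dot z y].
Proof.
move=> sz0.
have [U [UU oU]] := ultraFilterLemma (_ : ProperFilter (\oo : set_system nat)).
have [ws [z [sz wU xU]]] := ultrafilter_cluster U sz0 oU.
exists ws, z; split=> // [j|i] y; apply: cvg_ultrafilter => U' UU' oU'.
all: have [ws' [z' [sz' wU' xU']]] := ultrafilter_cluster U' sz0 oU'.
all: have [wsE zE] := weak_limit_unique ws z ws' z' U U' _ _ oU oU' sz sz' wU wU'.
- by rewrite wsE; exact: wU'.
- by rewrite zE; exact: xU'.
Qed.

End Iteration.
End Convergence.

(** * Weak convergence of the scheme *)

Theorem theorem3p8 (R : realType) (H : completeNormedModType R)
  (dot : {dot H for idfun}) (dot_norm : forall x : H, dot x x = `|x| ^+ 2)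
  (n : nat) (beta : R) (beta_gt0 : 0 < beta)
  (A : 'I_n.+2 -> H -> set H) (C : 'I_n.+1 -> H -> H)
  (A_maxmono : forall i, maximal_monotone dot (A i))
  (C_maxmono : forall i, maximal_monotone dot (op_of_fun (C i)))
  (C_coco : forall i, cocoercive dot beta^-1 (C i))
  (gamma : R) (gamma_gt0 : 0 < gamma) (gamma_lt : gamma < 4 / beta)
  (theta : nat -> R)
  (theta_bound : forall k, 0 <= theta k <= 2 - gamma * beta / 2)
  (theta_sum : \sum_(0 <= k < m) theta k * (2 - gamma * beta / 2 - theta k)
                 @[m --> \oo] --> +oo)
  (w : nat -> 'I_n.+1 -> H) (x : nat -> 'I_n.+2 -> H)
  (step : forall k,
     sfdr_step A C gamma (theta k) (w k) (w k.+1) (x k.+1)) :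
  (exists z : H, inclusion_solution A C z) ->
  exists ws : 'I_n.+1 -> H,
    weak_cvg (prod_dot dot (N := n.+1)) w ws /\
    let xs := resolvent (op_scale gamma (A ord0)) (ws ord0) in
    inclusion_solution A C xs /\
    forall i : 'I_n.+2, weak_cvg dot (fun k => x k i) xs.
Proof.
move=> [z0 /(inclusion_state dot_norm A C gamma gamma_gt0)[ws0 sz0]].
have sx k : sfdr_state A C gamma (w k) (x k.+1).
  exact: (sfdr_step_state dot_norm _ _ A_maxmono _ gamma_gt0 _ _ _ _ (step k)).
have wS k i : w k.+1 i = w k i + theta k *: residual (x k.+1) i.
  by have [_ _ _ ->] := step k.
have [ws [z [sz wlim xlim]]] := iteration_weak_cvg dot_norm beta beta_gt0 A C
  A_maxmono C_maxmono C_coco gamma gamma_gt0 gamma_lt theta theta_bound theta_sum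
  w (fun k => x k.+1) sx wS sz0.
exists ws; split=> [y|].
  by apply: cvg_big => //; exact: add_continuous.
rewrite (state_resolvent dot_norm A C A_maxmono gamma gamma_gt0 sz).
split=> [|i y].
  by apply/(inclusion_state dot_norm A C gamma gamma_gt0); exists ws.
rewrite -cvg_shiftS; exact: xlim.
Qed.
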